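(* Let $\mathfrak{D}=\sum_{j=0}^np_j(x)\left(\frac{d}{dx}\right)^j$ be a linear differential operator of order $n$ with polynomial coefficients $p_j(x)=\sum_{i=0}^{d_j}a_{i,j}x^i$, $d_j=\deg p_j$, let $g\in\mathcal{PD}(\mathfrak{D},p)$ on $[a,b]$, and let $\alpha_j=d_j-j$ for $j=0,\dots,n$. Then the moment recurrence system $$\vec w(k+1)=M(k)\,\vec w(k)$$ associated with $g$ (with the matrix $M(k)$ described in the context) is of Poincaré type if and only if $$\alpha_n\geq\alpha_j,\qquad j=0,1,\dots,n.$$
   Context: Let $a<b$ be real. A real-valued bounded integrable function $g:[a,b]\to\mathbb{R}$ belongs to the class $\mathcal{PD}(\mathfrak{D},p)$ if it has $0\leq p<\infty$ discontinuities (not including the endpoints), all of the first kind, and between the discontinuities it satisfies $\mathfrak{D}g=0$. Denote the discontinuities by $x_1<\dots<x_p$, and put $x_0=a$, $x_{p+1}=b$. Here $a_{d_j,j}\neq0$ whenever $p_j\not\equiv0$, $p_n\not\equiv0$, and $\alpha_j=-\infty$ if $p_j\equiv0$; $a_{i,j}=0$ for $i\notin\{0,\dots,d_j\}$. Let $\alpha=\max_j\alpha_j$, and for $\ell=-n,\dots,\alpha$ let $$q_\ell(k)=\sum_{j=0}^n(-1)^ja_{\ell+j,j}\,(k+\ell+j)_j,\qquad (u)_j=u(u-1)\cdots(u-j+1).$$ Let $m_k=\int_a^bx^kg(x)\,dx$ and $\varepsilon_k=\sum_{\ell=-n}^{\alpha}q_\ell(k)m_{k+\ell}$. Let $\tau=n(p+2)$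 and define $b_1,\dots,b_\tau$ by $$\prod_{j=0}^{p+1}(\sigma-x_j)^n=\sigma^\tau-\sum_{i=1}^\tau b_i\sigma^{\tau-i};$$ the sequence $\varepsilon_k$ satisfies $\varepsilon_{k+\tau}=\sum_{j=0}^{\tau-1}b_{\tau-j}\varepsilon_{k+j}$. Put $$\vec w(k)=(m_{k-n},\dots,m_{k+\alpha-1},\varepsilon_k,\dots,\varepsilon_{k+\tau-1})^T\in\mathbb{C}^{\alpha+n+\tau}.$$ Then $\vec w(k+1)=M(k)\vec w(k)$ (for $k$ large enough that $q_\alpha(k)\neq0$), where $$M(k)=\begin{bmatrix}M_{11}(k)&M_{12}(k)\\0&M_{22}\end{bmatrix}$$ and: $M_{11}(k)$ is the $(\alpha+n)\times(\alpha+n)$ matrix with $1$'s on the superdiagonal, last row $\left(-\frac{q_{-n}(k)}{q_\alpha(k)},-\frac{q_{-n+1}(k)}{q_\alpha(k)},\dots,-\frac{q_{\alpha-1}(k)}{q_\alpha(k)}\right)$, and zeros elsewhere; $M_{12}(k)$ is the $(\alpha+n)\times\tau$ matrix whose only nonzero entry is $\frac1{q_\alpha(k)}$ in the first column of the last row; $M_{22}$ is the $\tau\times\tau$ matrix with $1$'s on the superdiagonal, last row $(b_\tau,b_{\tau-1},\dots,b_1)$, and zeros elsewhere. A linear system $\vec y(k+1)=M(k)\vec y(k)$ is of Poincaré type if $M(k)=A+B(k)$ with $A$ a constant matrix and $\lim_{k\to\infty}\|B(k)\|=0$. *)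

(* Defs.v *)
(* The coefficients of the operator and the recurrence live in R[i] (real
   operators are a special case), while g is real valued. *)
From HB Require Import structures.
From mathcomp Require Import all_boot all_order all_algebra.
From mathcomp Require Import all_classical all_reals all_analysis.
From mathcomp Require Import complex.

Set Implicit Arguments.
Unset Strict Implicit.
Unset Printing Implicit Defensive.

Import Order.TTheory GRing.Theory Num.Theory.
Import numFieldNormedType.Exports.

Local Open Scope classical_set_scope.
Local Open Scope complex_scope.
Local Open Scope ring_scope.

(* A differential operator of order n, sum_(j <= n) p_j(x) (d/dx)^j, is given by
   its coefficients P : 'I_n.+1 -> {poly R[i]}, with P ord_max != 0. *)

Definition diffop_at (R : realType) (n : nat) (P : 'I_n.+1 -> {poly R[i]})
    (g : R -> R) (t : R) : R[i] :=
  \sum_(j < n.+1) (P j).[t%:C] * (derive1n j g t)%:C.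

(* x_0 = a < x_1 < ... < x_p < x_(p+1) = b *)
Definition nodes (R : realType) (p : nat) (a b : R) (x : p.-tuple R) : seq R :=
  a :: rcons x b.

(* g belongs to PD(D, p) on [a, b], with discontinuities x_1 < ... < x_p.
   Only the values of g on [a, b] matter. *)
Record PD (R : realType) (n : nat) (P : 'I_n.+1 -> {poly R[i]}) (a b : R)
    (p : nat) (x : p.-tuple R) (g : R -> R) : Prop := {
  PD_bounded : [bounded g t | t in `[a, b]%classic];
  PD_integrable :
    (@lebesgue_measure R).-integrable `[a, b]%classic (EFin \o g);
  PD_sorted : sorted <%R x;
  PD_discontinuities :
    forall t, t \in x <-> a < t < b /\ ~ {for t, continuous g};
  PD_first_kind :
    forall t, t \in x -> cvg (g s @[s --> t^'-]) /\ cvg (g s @[s --> t^'+]);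
  PD_equation :
    forall i : 'I_p.+1, forall t : R,
      (nodes a b x)`_i < t < (nodes a b x)`_i.+1 ->
      (forall j : nat, (j < n)%N -> derivable (derive1n j g) t 1)
      /\ diffop_at P g t = 0
}.

Section Recurrence.
Variables (R : realType) (n : nat) (P : 'I_n.+1 -> {poly R[i]}).

(* a_(i,j) for an arbitrary integer i *)
Definition coef_int (i : int) (j : 'I_n.+1) : R[i] :=
  if i is Posz m then (P j)`_m else 0.

Definition alpha_ (j : 'I_n.+1) : \bar int :=
  if P j == 0 then (-oo)%E else ((size (P j)).-1%:Z - j%:Z)%:E.

(* The maximum is finite as soon as some P j is nonzero, so fine only removes
   the constructor. *)
Definition alpha : int := fine (\big[maxe/-oo%E]_(j < n.+1) alpha_ j).

(* alpha + n, which is nonnegative if P ord_max != 0; see dim1E. *)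
Definition dim1 : nat := absz (alpha + n%:Z).

(* (u)_j = u (u - 1) ... (u - j + 1) *)
Definition falling (u : R[i]) (j : nat) : R[i] := \prod_(i < j) (u - i%:R).

Definition q_ (l : int) (k : nat) : R[i] :=
  \sum_(j < n.+1)
    (-1) ^+ j * coef_int (l + j%:Z) j * falling (k%:Z + l + j%:Z)%:~R j.

Variables (a b : R) (p : nat) (x : p.-tuple R).

Definition tau : nat := (n * (p + 2))%N.

Definition node_poly : {poly R[i]} :=
  \prod_(j < p.+2) ('X - ((nodes a b x)`_j)%:C%:P) ^+ n.

(* The b_i (1 <= i <= tau) of node_poly = X^tau - sum_i b_i X^(tau - i);
   see node_polyE. *)
Definition b_ (i : nat) : R[i] := - node_poly`_(tau - i).

Definition M11 (k : nat) : 'M[R[i]]_dim1 :=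
  \matrix_(i, j) if i.+1 == dim1
                 then - (q_ (j%:Z - n%:Z) k / q_ alpha k)
                 else (j == i.+1 :> nat)%:R.

Definition M12 (k : nat) : 'M[R[i]]_(dim1, tau) :=
  \matrix_(i, j) if (i.+1 == dim1) && (j == 0 :> nat)
                 then (q_ alpha k)^-1 else 0.

Definition M22 : 'M[R[i]]_tau :=
  \matrix_(i, j) if i.+1 == tau then b_ (tau - j) else (j == i.+1 :> nat)%:R.

(* Matrix M(k) of the moment recurrence system w(k+1) = M(k) w(k) of g, where
   w(k) = (m_(k-n), ..., m_(k+alpha-1), e_k, ..., e_(k+tau-1)),
   m_k is the integral of t^k g(t) over [a, b] and
   e_k = sum_(-n <= l <= alpha) q_ l k * m_(k+l).
   It is only meaningful where q_ alpha k != 0, that is, for all large k. *)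
Definition moment_matrix (k : nat) : 'M[R[i]]_(dim1 + tau) :=
  block_mx (M11 k) (M12 k) 0 M22.

Lemma node_polyE :
  node_poly = 'X^tau - \sum_(1 <= i < tau.+1) b_ i *: 'X^(tau - i).
Proof.
have mon j : ('X - ((nodes a b x)`_j)%:C%:P : {poly R[i]}) ^+ n \is monic.
  by apply: monic_exp; exact: monicXsubC.
have pm : node_poly \is monic by apply: monic_prod => j _; exact: mon.
have ps : size node_poly = tau.+1.
  rewrite /node_poly size_prod; last by move=> j _; exact: monic_neq0.
  under eq_bigr do rewrite size_exp_XsubC.
  by rewrite sum_nat_const card_ord mulnS -addnS addKn mulnC /tau addn2.
have -> : node_poly = \poly_(i < tau.+1) node_poly`_i by rewrite -ps coefK.
rewrite poly_def big_ord_recr /= addrC.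
have -> : node_poly`_tau = 1 by move/monicP: pm; rewrite lead_coefE ps.
rewrite scale1r; congr (_ + _).
rewrite big_add1 big_mkord -sumrN (reindex_inj rev_ord_inj) /=.
by apply: eq_bigr => i _; rewrite /b_ scaleNr opprK.
Qed.

Lemma dim1E : P ord_max != 0 -> dim1%:Z = alpha + n%:Z.
Proof.
move=> Pn; rewrite /dim1 gez0_abs //.
have le_max : (alpha_ ord_max <= \big[maxe/-oo]_(j < n.+1) alpha_ j)%E.
  exact: le_bigmax.
have lt_max : (\big[maxe/-oo]_(j < n.+1) alpha_ j < +oo)%E.
  by apply/bigmax_ltP; split=> // j _; rewrite /alpha_; case: ifP => // _; rewrite ltry.
rewrite /alpha; move: le_max lt_max; rewrite {1}/alpha_ (negPf Pn).
case: (\big[_/_]_(_ < _) _)%E => [r| |] //=; rewrite lee_fin => le_r _.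
by rewrite -lerBlDr sub0r (le_trans _ le_r) // lerDr.
Qed.

End Recurrence.

(* The system y(k+1) = M(k) y(k) is of Poincare type.  Only large k matter, as
   M(k) need only be defined for those. *)
Definition poincare_type (K : numFieldType) (m : nat) (M : nat -> 'M[K]_m) :=
  exists (A : 'M[K]_m) (B : nat -> 'M[K]_m),
    (\forall k \near \oo, M k = A + B k) /\ `|B k| @[k --> \oo] --> (0 : K).

(* Main.v *)
Require Import Defs.
From mathcomp Require Import all_boot all_order all_algebra.
From mathcomp Require Import all_classical all_reals all_analysis.
From mathcomp Require Import complex.

(** A system is of Poincare type exactly when every entry of its matrix
    converges ([poincare_typeP]).  In the moment matrix the only entries that
    vary with [k] are [- q_l(k) / q_alpha(k)] and [1 / q_alpha(k)], so the
    question is one about the growth of the polynomials [q_l].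

    As a function of [k], the [j]-th term of [q_l] is [a_(l+j,j)] times a monic
    polynomial of degree [j], up to sign.  Hence [deg q_l <= n], the coefficient
    of [k^n] in [q_l] is [+- a_(l+n,n)], and the degree of [q_l] is the largest
    [j] with [a_(l+j,j) != 0] ([coef_staircase]).  For [l = alpha] the
    coefficient [a_(alpha+j,j)] is the leading one of [p_j] if
    [alpha_j = alpha], and vanishes if [alpha_j < alpha].  So [q_alpha] is never
    the zero polynomial, and it has degree [n] exactly when [alpha_n = alpha].

    If [alpha_n = alpha], each varying entry is, up to sign, a quotient of a
    polynomial of degree at most [n] by one of degree [n], and it converges
    ([cvg_horner_ratio]).
    If [alpha_n < alpha], then [l = alpha_n] is among the indices of the last
    row of [M11], [q_l] has degree [n] because [a_(d_n,n) != 0], and [q_alpha]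
    has smaller degree: the quotient [q_l / q_alpha] diverges
    ([cvg_horner_ratio_coef0]).  *)

Set Implicit Arguments.
Unset Strict Implicit.
Unset Printing Implicit Defensive.

Import Order.TTheory GRing.Theory Num.Theory.
Import numFieldNormedType.Exports.

Local Open Scope classical_set_scope.
Local Open Scope complex_scope.
Local Open Scope ring_scope.

(** * Entrywise characterization of Poincare type *)

(** The constant part and the remainder are recovered as the entrywise limit
    and the difference; the norm is the largest modulus of finitely many
    entries, so it tends to 0 as soon as each of them does. *)
Lemma poincare_typeP {K : numFieldType} {m : nat} (M : nat -> 'M[K]_m) :
  poincare_type M <->
  exists A : 'M[K]_m, forall i j, M k i j @[k --> \oo] --> A i j.
Proof.
split=> [[A [B [MAB /norm_cvg0P/cvg_ballP B0]]]|[A cvgM]]; exists A.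
- move=> i j; apply/cvg_ballP => e e0; near=> k.
  rewrite (near MAB k)// mxE; have [_ /(_ i j)] : ball (0 : 'M[K]_m) e (B k).
    by near: k; exact: B0.
  by rewrite -!ball_normE/= mxE sub0r opprD addrA subrr sub0r.
- exists (fun k => M k - A); split.
    by apply: nearW => k; rewrite addrC subrK.
  apply/norm_cvg0P/cvg_ballP => e e0.
  have : \forall k \near \oo, forall i j, ball (A i j) e (M k i j).
    apply: filter_forall => i; apply: filter_forall => j.
    by move/cvg_ballP: (cvgM i j); exact.
  apply: filterS => k MA; split=> // i j.
  by have := MA i j; rewrite -!ball_normE/= !mxE sub0r opprB.
Unshelve. all: by end_near. Qed.

(** * Growth of polynomials along the natural numbers *)

(** [R[i]] is Archimedean because its positive elements are real. *)
Lemma cvg_natrV_complex (R : realType) :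
  (k%:R^-1 : (R[i] : numFieldType)) @[k --> \oo] --> (0 : (R[i] : numFieldType)).
Proof.
apply/cvgr0Pnorm_lt => e e0.
have eR : e = (complex.Re e)%:C.
  by move: e0; case: e => x y; rewrite ltcE /= => /andP[/eqP -> _].
have r0 : 0 < complex.Re e by rewrite -ltcR -eR.
near=> k.
have k0 : (0 < k)%N by near: k; exact: nbhs_infty_gt.
rewrite normfV normr_nat eR -(rmorph_nat (real_complex R)) -fmorphV ltcR.
rewrite invf_plt ?posrE ?ltr0n//.
by near: k; exact: nbhs_infty_gtr.
Unshelve. all: by end_near. Qed.

Section PolynomialGrowth.
Variable K : numFieldType.
Hypothesis cvg_natrV : (k%:R^-1 : K) @[k --> \oo] --> (0 : K).
Implicit Types p r s : {poly K}.

Lemma continuous_horner_numField p : continuous (horner p).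
Proof.
elim/poly_ind: p => [|p c IHp] x.
  rewrite (_ : horner 0 = cst 0); first by move=> ?; exact: cst_continuous.
  by apply/funext => y; rewrite horner0.
rewrite (_ : horner _ = (horner p \* id) \+ cst c); last first.
  by apply/funext => y; rewrite hornerMXaddC.
apply: continuousD; last exact: cst_continuous.
by apply: continuousM; [exact: IHp|exact: cvg_id].
Qed.

(** Dividing by [k^n] turns [p] evaluated at [k] into its reversal evaluated at
    [1 / k], a quantity continuous at [1 / k = 0].  Taking [n] as a mere bound
    on the degree lets one normalization serve numerator and denominator of a
    quotient, whatever their exact degrees. *)
Lemma cvg_horner_natr p n : (size p <= n.+1)%N ->
  (p.[k%:R] / k%:R ^+ n) @[k --> \oo] --> p`_n.
Proof.
move=> sp; pose r := \poly_(i < n.+1) p`_(n - i).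
have -> : p`_n = r.[0] by rewrite horner_coef0 coef_poly /= subn0.
have h : r.[k%:R^-1] @[k --> \oo] --> r.[0].
  by apply: (cvg_comp _ (horner r) cvg_natrV); exact: continuous_horner_numField.
apply: cvg_trans h; apply: near_eq_cvg; near=> k.
have k0 : k%:R != 0 :> K.
  by rewrite pnatr_eq0 -lt0n; near: k; exact: nbhs_infty_gt.
rewrite horner_poly (horner_coef_wide _ sp) mulr_suml (reindex_inj rev_ord_inj).
apply: eq_bigr => i _ /=; have le_in : (i <= n)%N by rewrite -ltnS.
rewrite !subSS subKn// -mulrA; congr (_ * _).
by rewrite exprVn -[in k%:R ^+ n](subnK le_in) exprD invfM mulrCA divff ?mulr1// expf_neq0.
Unshelve. all: by end_near. Qed.

Lemma near_horner_natr_neq0 p : p != 0 -> \forall k \near \oo, p.[k%:R] != 0.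
Proof.
move=> p0; have sp : (size p <= (size p).-1.+1)%N by rewrite leqSpred.
have /cvgr_neq0 := cvg_horner_natr sp.
rewrite -lead_coefE lead_coef_eq0 => /(_ p0); apply: filterS => k.
by apply: contra_neq => ->; rewrite mul0r.
Qed.

Lemma cvg_horner_ratio r s n : (size r <= n.+1)%N -> (size s <= n.+1)%N ->
  s`_n != 0 -> r.[k%:R] / s.[k%:R] @[k --> \oo] --> r`_n / s`_n.
Proof.
move=> sr ss sn0.
have h : (r.[k%:R] / k%:R ^+ n) * (s.[k%:R] / k%:R ^+ n)^-1 @[k --> \oo] -->
    r`_n / s`_n.
  apply: cvgM; first exact: cvg_horner_natr.
  by apply: cvgV => //; exact: cvg_horner_natr.
apply: cvg_trans h; apply: near_eq_cvg; near=> k.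
have k0 : k%:R != 0 :> K.
  by rewrite pnatr_eq0 -lt0n; near: k; exact: nbhs_infty_gt.
by rewrite /= invfM invrK mulrACA mulVf ?expf_neq0// mulr1.
Unshelve. all: by end_near. Qed.

(** As the quotient has a limit,
    [r(k) / k^n = (r(k) / s(k)) * (s(k) / k^n)] tends to 0.  The condition
    [s != 0] is essential: with [x / 0 = 0], the quotient by the zero polynomial
    converges. *)
Lemma cvg_horner_ratio_coef0 r s n (L : K) :
  (size r <= n.+1)%N -> (size s <= n.+1)%N -> s != 0 -> s`_n = 0 ->
  r.[k%:R] / s.[k%:R] @[k --> \oo] --> L -> r`_n = 0.
Proof.
move=> sr ss s0 sn0 rsL.
have h : (r.[k%:R] / s.[k%:R]) * (s.[k%:R] / k%:R ^+ n) @[k --> \oo] --> (0 : K).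
  by rewrite -(mulr0 L) -sn0; apply: cvgM => //; exact: cvg_horner_natr.
apply: cvg_unique (cvg_horner_natr sr) _; first exact: norm_hausdorff.
apply: cvg_trans h; apply: near_eq_cvg; near=> k.
rewrite /= mulrA divfK//.
by near: k; exact: near_horner_natr_neq0.
Unshelve. all: by end_near. Qed.

End PolynomialGrowth.

(** * Combinations of monic polynomials of degrees 0, ..., n *)

Section Staircase.
Variables (K : fieldType) (n : nat) (F : 'I_n.+1 -> {poly K}).
Hypothesis F_monic : forall j, F j \is monic.
Hypothesis size_F : forall j, size (F j) = j.+1.
Implicit Type c : 'I_n.+1 -> K.

Lemma size_staircase c : (size (\sum_j c j *: F j)%R <= n.+1)%N.
Proof.
apply/leq_sizeP => i ni; rewrite coef_sum big1// => j _.
by rewrite coefZ nth_default ?mulr0// size_F (leq_trans (ltn_ord j)).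
Qed.

(** The terms of index above [m] vanish and those below have degree less than
    [m], so only the leading coefficient of [F m] contributes. *)
Lemma coef_staircase c (m : 'I_n.+1) :
  (forall j : 'I_n.+1, (m < j)%N -> c j = 0) ->
  (\sum_j c j *: F j)`_m = c m.
Proof.
move=> cm; rewrite coef_sum (bigD1 m)//= big1 ?addr0 => [|j jm].
  have /monicP := F_monic m; rewrite lead_coefE size_F coefZ /= => ->.
  by rewrite mulr1.
rewrite coefZ; have [/cm ->|] := ltnP m j; first by rewrite mul0r.
by rewrite leq_eqVlt val_eqE (negPf jm)/= => ?; rewrite nth_default ?mulr0 ?size_F.
Qed.

Lemma staircase_neq0 c (i : 'I_n.+1) : c i != 0 -> \sum_j c j *: F j != 0.
Proof.
move=> ci0.
have [m cm0 mmax] := @arg_maxnP _ i (fun j => c j != 0) (@nat_of_ord _) ci0.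
apply: contraNneq cm0 => S0; rewrite -[c m]coef_staircase ?S0 ?coef0//.
by move=> j; apply: contraTeq => /mmax; rewrite -leqNgt.
Qed.

End Staircase.

(** * The coefficients q_l of the recurrence as polynomials in k *)

(** The polynomial [(X + c)_j] as a product of linear factors
    [X - (i - c)]. *)
Definition falling_poly {K : comNzRingType} (c : K) (j : nat) : {poly K} :=
  \prod_(i < j) ('X - (i%:R - c)%:P).

Lemma size_falling_poly {K : comNzRingType} (c : K) j :
  size (falling_poly c j) = j.+1.
Proof. by rewrite size_prod_XsubC /index_enum -enumT size_enum_ord. Qed.

Lemma monic_falling_poly {K : comNzRingType} (c : K) j :
  falling_poly c j \is monic.
Proof. exact: monic_prod_XsubC. Qed.

Lemma horner_falling_poly {R : realType} (c u : R[i]) j :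
  (falling_poly c j).[u] = falling (u + c) j.
Proof.
rewrite horner_prod; apply: eq_bigr => i _.
by rewrite hornerXsubC opprB addrCA addrC addrAC.
Qed.

Section Operator.
Variables (R : realType) (n : nat) (P : 'I_n.+1 -> {poly R[i]}).

Definition q_poly (l : int) : {poly R[i]} :=
  \sum_(j < n.+1)
    ((-1) ^+ j * coef_int P (l + j%:Z) j) *: falling_poly (l + j%:Z)%:~R j.

Lemma horner_q_poly l k : (q_poly l).[k%:R] = q_ P l k.
Proof.
rewrite horner_sum; apply: eq_bigr => j _.
by rewrite hornerZ horner_falling_poly -addrA [in RHS]rmorphD.
Qed.

Lemma size_q_poly l : (size (q_poly l) <= n.+1)%N.
Proof. by apply: size_staircase => j; exact: size_falling_poly. Qed.

Lemma coef_q_poly l :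
  (q_poly l)`_n = (-1) ^+ n * coef_int P (l + n%:Z) ord_max.
Proof.
apply: (@coef_staircase _ _ _ _ _
  (fun j => (-1) ^+ j * coef_int P (l + j%:Z) j) ord_max) => [j|j|j /=].
- exact: monic_falling_poly.
- exact: size_falling_poly.
- by rewrite ltnNge -ltnS ltn_ord.
Qed.

Lemma q_poly_neq0 l (j : 'I_n.+1) : coef_int P (l + j%:Z) j != 0 ->
  q_poly l != 0.
Proof.
move=> cj0; apply: (@staircase_neq0 _ _ _ _ _ _ j) => [i|i|].
- exact: monic_falling_poly.
- exact: size_falling_poly.
- by rewrite mulf_neq0 ?signr_eq0.
Qed.

(** Here [l + j] is the degree of [P j]. *)
Lemma coef_int_alpha (j : 'I_n.+1) l : alpha_ P j = l%:E ->
  coef_int P (l + j%:Z) j != 0.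
Proof.
rewrite /alpha_; case: ifPn => // Pj0 [<-].
by rewrite subrK /= -lead_coefE lead_coef_eq0.
Qed.

(** Here [l + j] exceeds the degree of [P j]. *)
Lemma coef_int_gt_alpha (j : 'I_n.+1) l : (alpha_ P j < l%:E)%E ->
  coef_int P (l + j%:Z) j = 0.
Proof.
rewrite /alpha_ /coef_int; case: ifPn => [/eqP ->|_].
  by case: (l + _) => // m; rewrite coef0.
rewrite lte_fin ltrBlDr; case: (l + _) => // m; rewrite ltz_nat => lt_m.
by rewrite nth_default// (leq_trans (leqSpred _)).
Qed.

(** As [P ord_max != 0], the maximum of the [alpha_ P j] is finite, so [fine]
    does not alter it. *)
Lemma alpha_spec : P ord_max != 0 ->
  (forall j, (alpha_ P j <= (alpha P)%:E)%E) /\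
  exists j, alpha_ P j = (alpha P)%:E.
Proof.
move=> Pn0.
have [j _ maxE] := eq_bigmax ord_max predT (alpha_ P) isT
  (fun i _ => leNye (alpha_ P i)).
have max_fin : (\big[maxe/-oo]_(j < n.+1) alpha_ P j)%E = (alpha P)%:E.
  have := le_bigmax (-oo)%E (alpha_ P) ord_max.
  rewrite /alpha maxE {1}/alpha_ (negPf Pn0) /alpha_.
  by case: ifP.
by split; [move=> i; rewrite -max_fin le_bigmax|exists j; rewrite -maxE].
Qed.

Lemma q_poly_alpha_neq0 : P ord_max != 0 -> q_poly (alpha P) != 0.
Proof.
by move=> /alpha_spec[_ [j /coef_int_alpha]]; exact: q_poly_neq0.
Qed.

(** The criterion behind the equivalence: [q_alpha] has degree [n] exactly when
    [alpha_n] attains the maximum [alpha]. *)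
Lemma coef_q_poly_alpha_eq0 : P ord_max != 0 ->
  ((q_poly (alpha P))`_n == 0) = (alpha_ P ord_max < (alpha P)%:E)%E.
Proof.
move=> /alpha_spec[/(_ ord_max)]; rewrite le_eqVlt => /predU1P[an|lt_an] _.
  rewrite an ltxx coef_q_poly mulf_eq0 signr_eq0.
  exact/negbTE/coef_int_alpha.
by rewrite lt_an coef_q_poly (coef_int_gt_alpha lt_an) mulr0 eqxx.
Qed.

End Operator.

(** * The moment recurrence *)

Theorem lemma6p1 (R : realType) (n : nat) (P : 'I_n.+1 -> {poly R[i]})
    (P_order : P ord_max != 0)
    (a b : R) (ab : a < b) (p : nat) (x : p.-tuple R) (g : R -> R)
    (gPD : PD P a b x g) :
  poincare_type (moment_matrix P a b x) <->
  forall j : 'I_n.+1, (alpha_ P j <= alpha_ P ord_max)%E.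
Proof.
have [le_alpha [jmax jmaxE]] := alpha_spec P_order.
have cvg0 := @cvg_natrV_complex R.
rewrite poincare_typeP; split=> [[A cvg_entries] j|max_n].
- apply: le_trans (le_alpha j) _; rewrite leNgt; apply/negP => lt_n.
  have [d dE] : exists d : nat, alpha_ P ord_max = (d%:Z - n%:Z)%:E.
    by rewrite /alpha_ (negPf P_order); eexists.
  have qa0 : (q_poly P (alpha P))`_n = 0.
    by apply/eqP; rewrite coef_q_poly_alpha_eq0.
  have lt_d : (d < dim1 P)%N.
    by rewrite -ltz_nat dim1E// -ltrBlDr -lte_fin -dE.
  have lt_r : ((dim1 P).-1 < dim1 P)%N by rewrite ltn_predL (leq_ltn_trans _ lt_d).
  (* In the last row of M11, column d = deg p_n carries q_l with
     l = d - n = alpha_n. *)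
  have := cvg_entries (lshift _ (Ordinal lt_r)) (lshift _ (Ordinal lt_d)).
  under eq_fun do rewrite block_mxEul mxE /= prednK ?(leq_ltn_trans _ lt_d)// eqxx
    -!horner_q_poly -mulNr -hornerN.
  have size_N : (size (- q_poly P (d%:Z - n%:Z))%R <= n.+1)%N.
    by rewrite size_polyN size_q_poly.
  move=> /(cvg_horner_ratio_coef0 cvg0 size_N (size_q_poly _ _)
             (q_poly_alpha_neq0 P_order) qa0) /eqP.
  rewrite coefN oppr_eq0 coef_q_poly mulf_eq0 signr_eq0 /=.
  by apply/negP; exact: (coef_int_alpha (j := ord_max) dE).
- have qan : (q_poly P (alpha P))`_n != 0.
    by rewrite coef_q_poly_alpha_eq0// -jmaxE -leNgt.
  have cvg_ratio (r : {poly R[i]}) : (size r <= n.+1)%N ->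
      (r.[k%:R] / q_ P (alpha P) k) @[k --> \oo] -->
      (r`_n / (q_poly P (alpha P))`_n : (R[i] : numFieldType)).
    move=> sr; under eq_fun do rewrite -horner_q_poly.
    exact (cvg_horner_ratio cvg0 sr (size_q_poly _ _) qan).
  have cvg_const (c : (R[i] : numFieldType)) : c @[_ --> \oo] --> c.
    exact: cvg_cst.
  suff cvg_entry i j : exists l : (R[i] : numFieldType),
      moment_matrix P a b x k i j @[k --> \oo] --> l.
    exists (\matrix_(i, j) projT1 (cid (cvg_entry i j))) => i j.
    by rewrite mxE; case: cid.
  case: (split_ordP i) => i' ->; case: (split_ordP j) => j' ->.
  + case E: (i'.+1 == dim1 P); eexists; under eq_fun do rewrite block_mxEul mxE E.
      under eq_fun do rewrite -horner_q_poly -mulNr -hornerN.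
      by apply: cvg_ratio; rewrite size_polyN size_q_poly.
    exact: cvg_const.
  + case E: ((i'.+1 == dim1 P) && (j' == 0 :> nat)); eexists;
      under eq_fun do rewrite block_mxEur mxE E.
      under eq_fun => k do rewrite -div1r -[X in X / _](hornerC 1 k%:R).
      by apply: cvg_ratio; rewrite size_poly1.
    exact: cvg_const.
  + by eexists; under eq_fun do rewrite block_mxEdl mxE; exact: cvg_const.
  + by eexists; under eq_fun do rewrite block_mxEdr; exact: cvg_const.
Qed.
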